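(* Let $I,J\subset\mathbb{N}$ be disjoint infinite sets with $I\cup J=\mathbb{N}$. For each $j\in J$ fix a function $\varphi_j:\{0,\dots,p-1\}^j\to\{0,\dots,p-1\}$. For $\gamma\ge0$ define $$C_\gamma=\Big\{\sum_{i=0}^{\gamma-1}t_ip^i:\ t_i\in\{0,\dots,p-1\},\ t_j=\varphi_j(t_0,\dots,t_{j-1})\text{ for all }j\in J,\ j<\gamma\Big\}\subset\mathbb{Z}_p$$ and $\Omega_\gamma=\bigsqcup_{c\in C_\gamma}(c+p^\gamma\mathbb{Z}_p)$. Then $\Omega_0\supset\Omega_1\supset\cdots$. The probability measures $\mathfrak{m}|_{\Omega_\gamma}/\mathfrak{m}(\Omega_\gamma)$ converge weakly to a probability measure $\mu_{I,J}$, which is singular with respect to $\mathfrak{m}$. Moreover, $\mu_{I,J}$ is a spectral measure with spectrum $$\Lambda=\Big\{\sum_{i\in I}b_ip^{-i-1}:\ b_i\in\{0,\dots,p-1\},\ \text{only finitely many }b_i\neq0\Big\}.$$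
   Context: $p\ge2$ is a prime and $\mathbb{N}=\{0,1,2,\dots\}$. $\mathbb{Q}_p$ and $\mathbb{Z}_p$ are the $p$-adic numbers and $p$-adic integers, with valuation $v_p$. $\mathfrak{m}$ is the Haar measure on $\mathbb{Q}_p$ with $\mathfrak{m}(\mathbb{Z}_p)=1$. Characters: $\chi(x)=e^{2\pi i\{x\}}$, where $\{x\}=\sum_{n=v_p(x)}^{-1}a_np^n$ is the fractional part of $x=\sum_{n\ge v_p(x)}a_np^n$ with digits $a_n\in\{0,\dots,p-1\}$. Also $\chi_y(x)=\chi(yx)$. Spectral measure: a Borel probability measure $\mu$ is spectral with spectrum $\Lambda$ if $\{\chi_\lambda\}_{\lambda\in\Lambda}$ is an orthonormal basis of $L^2(\mu)$. *)

(* Defs.v *)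
From HB Require Import structures.
From mathcomp Require Import all_boot all_order all_algebra.
From mathcomp Require Import all_classical all_reals all_analysis.
Set Implicit Arguments. Unset Strict Implicit. Unset Printing Implicit Defensive.
Import Order.TTheory GRing.Theory Num.Theory.
Import numFieldNormedType.Exports.
Local Open Scope classical_set_scope.
Local Open Scope ring_scope.

(* A p-adic digit in {0,...,p-1}.  We write 'I_p.-1.+1 (which is 'I_p for
   p >= 1, in particular for p prime) so that the type is inhabited. *)
Definition digit (p : nat) := 'I_p.-1.+1.

(* Z_p is modelled by its digit expansions x = sum_{n>=0} x_n p^n. *)
Definition Zp_dig (p : nat) := nat -> digit p.
HB.instance Definition _ (p : nat) := Choice.copy (Zp_dig p) (nat -> digit p).
HB.instance Definition _ (p : nat) :=
  isPointed.Build (Zp_dig p) (fun _ => ord0).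

(* zval n x = x_0 + x_1 p + ... + x_{n-1} p^{n-1} = (x mod p^n) as a natural. *)
Definition zval (p n : nat) (x : Zp_dig p) : nat :=
  (\sum_(k < n) x k * p ^ k)%N.

(* the ball x + p^n Z_p *)
Definition cylinder (p n : nat) (x : Zp_dig p) : set (Zp_dig p) :=
  [set y | forall i, (i < n)%N -> y i = x i].

(* open sets of Z_p (p-adic topology = product topology of discrete digits) *)
Definition zp_open (p : nat) (A : set (Zp_dig p)) : Prop :=
  forall x, A x -> exists n, cylinder n x `<=` A.

Notation Zpadic p := (g_sigma_algebraType (@zp_open p)).

(* p-adic addition: the n-th digit of x + y is read off
   (x + y) mod p^(n+1) = (zval (n+1) x + zval (n+1) y) mod p^(n+1). *)
Definition zp_add (p : nat) (x y : Zp_dig p) : Zp_dig p :=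
  fun i => inord (((zval i.+1 x + zval i.+1 y) %% p ^ i.+1) %/ p ^ i)%N.

Definition zp_continuous (R : realType) (p : nat) (f : Zp_dig p -> R) : Prop :=
  forall U : set R, open U -> zp_open (f @^-1` U).

Definition C_set (p : nat) (J : set nat)
  (phi : forall j : nat, {ffun 'I_j -> digit p} -> digit p) (g : nat) : set nat :=
  [set c | exists t : Zp_dig p,
     (forall j, J j -> (j < g)%N -> t j = phi j [ffun i : 'I_j => t i]) /\
     c = zval g t].

(* Omega_gamma = union_{c in C_gamma} (c + p^gamma Z_p); x lies in
   c + p^gamma Z_p (with 0 <= c < p^gamma) iff x mod p^gamma = c. *)
Definition Omega (p : nat) (J : set nat)
  (phi : forall j : nat, {ffun 'I_j -> digit p} -> digit p) (g : nat)
  : set (Zpadic p) :=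
  [set x | exists2 c, C_set J phi g c & zval g x = c].

(* The candidate spectrum, as a set of rationals (Q is a subset of Q_p) *)
Definition Lambda (p : nat) (I : set nat) : set rat :=
  [set q | exists (b : nat -> nat) (N : nat),
     (forall i, (b i < p)%N) /\
     (forall i, b i != 0%N -> I i /\ (i < N)%N) /\
     q = \sum_(i < N) (b i)%:R / (p%:R ^+ i.+1)].

(* Fractional part {q x} for q in Z[1/p] (denq q = p^N) and x in Z_p:
   q x = numq q * x / p^N and x = zval N x mod p^N Z_p, hence
   {q x} = ((numq q * zval N x) mod p^N) / p^N.
   chi_q(x) = exp(2 pi i {q x}). *)
Definition phase (R : realType) (p : nat) (q : rat) (x : Zp_dig p) : R :=
  ((numq q * (zval (logn p `|denq q|%N) x)%:Z) %% denq q)%Z%:~R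
  / (denq q)%:~R.

(* Main.v *)
Require Import Defs.
From HB Require Import structures.
From mathcomp Require Import all_boot all_order all_algebra.
From mathcomp Require Import all_classical all_reals all_analysis.
From mathcomp Require Import measurable_realfun zify ring lra.
Set Implicit Arguments. Unset Strict Implicit. Unset Printing Implicit Defensive.
Import Order.TTheory GRing.Theory Num.Theory.
Import numFieldNormedType.Exports.
Local Open Scope classical_set_scope.
Local Open Scope ring_scope.

(** The limit measure [mu] is the image of Haar measure under the map [fill]
    that keeps the digits of index in [I] and replaces, in increasing order,
    each digit of index [j] in [J] by the value of [phi j] on the preceding
    ones.  A ball of radius [p ^- n] has [mu]-mass either [0] or a constant
    [weight n], according to whether it meets [Omega n], so [mu] and the
    normalized restriction of [m] to [Omega n] agree on all functions of the
    first [n] digits; uniform continuity gives weak convergence.  Singularity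
    holds because [mu] lives on the intersection of the [Omega n], while
    [m (Omega n)] loses a factor [p] at each element of [J].

    Orthogonality: if two elements of Lambda last differ at [p ^- n.+1], with
    [n] in [I], cyclically shifting the digit [x n] preserves [mu] on balls of
    radius [p ^- n.+1] and multiplies the product of characters by a
    nontrivial [p]-th root of unity.  Completeness: dually, if two admissible
    [x], [s] first differ at digit [i], then [i] is in [I], and cyclically
    shifting the coefficient of [p ^- i.+1] shows that the sum over
    Lambda of [chi_l (x - s)] up to level [N] vanishes.  Hence indicators of
    balls are combinations of characters [mu]-a.e., and a function orthogonal
    to all characters has integral 0 on every ball. *)

(** * Digit truncations, balls and residues modulo powers of [p] *)

Definition trunc (p n : nat) (x : Zp_dig p) : {ffun 'I_n -> digit p} :=
  [ffun i : 'I_n => x i].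

(** The digits from [n] on are set to 0: this is the representative in [0, p^n) of a ball of radius
    p^-n. Used on coefficient strings, it makes the coefficients past [n] vanish. *)
Definition untrunc (p n : nat) (t : {ffun 'I_n -> digit p}) : Zp_dig p :=
  fun i => if insub i is Some j then t j else ord0.

Definition fiber (p n : nat) (t : {ffun 'I_n -> digit p}) : set (Zpadic p) :=
  [set x | trunc n x = t].

Section Digits.
Variable p : nat.
Hypothesis p_gt1 : (1 < p)%N.
Implicit Types x y z : Zp_dig p.

Let p_gt0 : (0 < p)%N. Proof. exact: ltnW. Qed.

Lemma digit_lt (d : digit p) : (d < p)%N.
Proof. by apply: leq_trans (ltn_ord d) _; rewrite prednK. Qed.

Lemma trunc_eqP n x y :
  trunc n x = trunc n y <-> (forall i, (i < n)%N -> x i = y i).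
Proof.
split=> [/ffunP e i lin|e]; first by have := e (Ordinal lin); rewrite !ffunE.
by apply/ffunP => i; rewrite !ffunE e.
Qed.

Lemma trunc_eqS n x y :
  trunc n.+1 x = trunc n.+1 y <-> trunc n x = trunc n y /\ x n = y n.
Proof.
rewrite !trunc_eqP; split=> [e|[e en] i].
  by split=> [i lin|]; apply: e => //; exact: ltnW.
by rewrite ltnS leq_eqVlt => /predU1P[->//|]; exact: e.
Qed.

Lemma trunc_eq_le m n x y : (m <= n)%N -> trunc n x = trunc n y ->
  trunc m x = trunc m y.
Proof. by move=> mn; rewrite !trunc_eqP => e i im; apply/e/(leq_trans im). Qed.

Lemma untruncE n (t : {ffun 'I_n -> digit p}) (i : 'I_n) : untrunc t i = t i.
Proof. by rewrite /untrunc insubT //= => lt; congr (t _); apply: val_inj. Qed.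

Lemma untruncK n : cancel (@untrunc p n) (@trunc p n).
Proof. by move=> t; apply/ffunP => i; rewrite ffunE untruncE. Qed.

Lemma cylinderE n x : cylinder n x = fiber (trunc n x).
Proof.
by apply/seteqP; split=> y /= => [e|/trunc_eqP//]; apply/trunc_eqP.
Qed.

Lemma zvalS n x : zval n.+1 x = (zval n x + x n * p ^ n)%N.
Proof. by rewrite /zval big_ord_recr. Qed.

Lemma zval_lt n x : (zval n x < p ^ n)%N.
Proof.
elim: n => [|n ih]; first by rewrite /zval big_ord0.
rewrite zvalS expnS; have := digit_lt (x n); move: ih; set a := zval n x.
move=> la lx; have := leq_mul2r (p ^ n) (x n).+1 p; rewrite lx orbT => h.
by apply: leq_trans h; rewrite mulSn ltn_add2r.
Qed.

Lemma zval_trunc n x y : trunc n x = trunc n y -> zval n x = zval n y.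
Proof. by move=> /trunc_eqP e; apply: eq_bigr => i _; rewrite e. Qed.

Lemma zval_mod m n x : (m <= n)%N -> (zval n x %% p ^ m)%N = zval m x.
Proof.
move=> /subnK <-; elim: (n - m)%N => [|k ih].
  by rewrite modn_small ?zval_lt.
by rewrite addSn zvalS -modnDmr expnD mulnA modnMl addn0.
Qed.

Lemma zval_div n x : (zval n.+1 x %/ p ^ n)%N = x n.
Proof. by rewrite zvalS addnC divnMDl ?expn_gt0 ?p_gt0// divn_small ?zval_lt ?addn0. Qed.

Lemma zval_inj n x y : zval n x = zval n y -> trunc n x = trunc n y.
Proof.
move=> e; apply/trunc_eqP => i lin; apply: val_inj => /=.
by rewrite -(zval_div i x) -(zval_div i y) -!(zval_mod _ lin) e.
Qed.

Lemma zval_ext x y : (forall n, zval n x = zval n y) -> x = y.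
Proof. by move=> e; apply/funext => n; have /zval_inj/trunc_eqS[] := e n.+1. Qed.

(** Z_p is the inverse limit of the Z/p^n: a compatible sequence of residues comes from a digit
    sequence. *)
Lemma zval_coherent (a : nat -> nat) : (forall n, a n < p ^ n)%N ->
    (forall n, a n.+1 %% p ^ n = a n)%N ->
  forall n, zval n (fun i => inord (a i.+1 %/ p ^ i)%N : digit p) = a n.
Proof.
move=> alt amod; elim=> [|n ih].
  by rewrite /zval big_ord0; have := alt 0%N; rewrite expn0; case: (a 0%N).
rewrite zvalS ih inordK; last first.
  by rewrite prednK// ltn_divLR ?expn_gt0 ?p_gt0// -expnS.
by rewrite -{1}(amod n) addnC -divn_eq.
Qed.

Lemma zval_add n x y : zval n (zp_add x y) = ((zval n x + zval n y) %% p ^ n)%N.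
Proof.
apply: (zval_coherent (a := fun n => (zval n x + zval n y) %% p ^ n)%N) => k.
  by rewrite ltn_mod expn_gt0 p_gt0.
rewrite modn_dvdm ?dvdn_exp2l// -modnDm; congr (_ %% _)%N.
by rewrite !zval_mod.
Qed.

(** The point [y] is z - x, built from its residues [a n]; adding p^n first avoids truncated
    subtraction. The second clause says that z - x lies in p^n Z_p once [x] and [z] share [n]
    digits. *)
Lemma zp_add_surj x z : exists y, zp_add x y = z /\
  forall n, trunc n z = trunc n x -> zval n y = 0%N.
Proof.
pose a n := ((zval n z + (p ^ n - zval n x)) %% p ^ n)%N.
have aS n : (a n.+1 %% p ^ n)%N = a n.
  rewrite /a modn_dvdm ?dvdn_exp2l//; apply/eqP.
  rewrite -(eqn_modDr (zval n x)) -[X in _ == X %[mod _]]addnA.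
  rewrite subnK; last exact/ltnW/zval_lt.
  rewrite -[X in (_ + X)%N == _ %[mod _]](zval_mod x (leqnSn n)) modnDmr -addnA.
  rewrite subnK; last exact/ltnW/zval_lt.
  by rewrite expnS -modnDmr modnMl addn0 modnDr zval_mod// modn_small// zval_lt.
have alt n : (a n < p ^ n)%N by rewrite ltn_mod expn_gt0 p_gt0.
exists (fun i => inord (a i.+1 %/ p ^ i)%N); split.
  apply: zval_ext => n; rewrite zval_add zval_coherent// /a modnDmr addnC -addnA.
  by rewrite subnK ?(ltnW (zval_lt _ _))// modnDr modn_small// zval_lt.
move=> n /zval_trunc e; rewrite zval_coherent// /a e subnKC ?modnn//.
exact/ltnW/zval_lt.
Qed.

(** Every ball is a translate of p^n Z_p; translation invariance of [m] is applied in this form. *)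
Lemma zp_add_cylinder n x : zp_add x @` cylinder n (fun=> ord0) = cylinder n x.
Proof.
have z0 : zval n (fun=> ord0 : digit p) = 0%N by rewrite /zval big1.
rewrite !cylinderE; apply/seteqP; split=> [_ [y y0 <-]|z zx].
  rewrite /fiber /=; apply: zval_inj; rewrite zval_add (zval_trunc y0) z0.
  by rewrite addn0 modn_small ?zval_lt.
have [y [e y0]] := zp_add_surj x z; exists y; last exact: e.
by rewrite /fiber /=; apply: zval_inj; rewrite y0.
Qed.

End Digits.

(** * The filling map and membership in [Omega] *)

Section Fill.
Variables (p : nat) (J : set nat).
Variable phi : forall j : nat, {ffun 'I_j -> digit p} -> digit p.
Implicit Types x y : Zp_dig p.

Lemma OmegaE n : (1 < p)%N ->
  Omega J phi n =
  [set x | forall j, J j -> (j < n)%N -> x j = phi (trunc j x)].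
Proof.
move=> p1; apply/seteqP; split=> [x [c [t [tJ ->]]] /(zval_inj p1) xt|x xJ].
  move=> j Jj jn; have /trunc_eqP -> // := xt.
  by rewrite tJ//; congr (phi _); exact/esym/(trunc_eq_le (ltnW jn) xt).
by exists (zval n x) => //; exists x; split.
Qed.

Lemma Omega_trunc n x y : (1 < p)%N -> trunc n x = trunc n y ->
  Omega J phi n x -> Omega J phi n y.
Proof.
move=> p1 xy; rewrite OmegaE//= => xJ j Jj jn.
move/trunc_eqP : (xy) => <-//.
by rewrite xJ// (trunc_eq_le (ltnW jn) xy).
Qed.

Lemma Omega_le m n : (1 < p)%N -> (m <= n)%N ->
  Omega J phi n `<=` Omega J phi m.
Proof.
by move=> p1 mn x; rewrite !OmegaE// => xJ j Jj jm; apply: xJ => //; exact: leq_trans mn.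
Qed.

Lemma OmegaS_J n x : (1 < p)%N -> J n ->
  Omega J phi n.+1 x <-> Omega J phi n x /\ x n = phi (trunc n x).
Proof.
move=> p1 Jn; rewrite !OmegaE//=; split=> [xJ|[xJ xn] j Jj].
  by split=> [j Jj jn|]; apply: xJ => //; exact: ltnW.
by rewrite ltnS leq_eqVlt => /predU1P[->//|]; exact: xJ.
Qed.

Lemma OmegaS_notJ n x : (1 < p)%N -> ~ J n ->
  Omega J phi n.+1 x <-> Omega J phi n x.
Proof.
move=> p1 Jn; rewrite !OmegaE//=; split=> xJ j Jj.
  by move=> jn; apply: xJ => //; exact: ltnW.
by rewrite ltnS leq_eqVlt => /predU1P[jn|]; [rewrite jn in Jj|exact: xJ].
Qed.

(** Indices are treated in increasing order, so that [phi k] reads digits already filled. Stage [n]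
    is final on indices below [n], which lets [fill] read digit [i] off stage [i.+1]. *)
Fixpoint fill_upto n x : Zp_dig p :=
  if n is k.+1 then
    let y := fill_upto k x in
    fun i => if `[< J k >] && (i == k) then phi (trunc k y) else y i
  else x.

Definition fill (x : Zpadic p) : Zpadic p := fun i => fill_upto i.+1 x i.

Lemma fill_upto_ge n x i : (n <= i)%N -> fill_upto n x i = x i.
Proof.
elim: n => [//|n ih] ni /=; rewrite gtn_eqF// andbF ih//; exact: ltnW.
Qed.

Lemma fill_upto_lt n x i : (i < n)%N -> fill_upto n x i = fill x i.
Proof.
elim: n => [//|n ih]; rewrite ltnS leq_eqVlt => /predU1P[->//|lin] /=.
by rewrite ltn_eqF// andbF ih.
Qed.

Lemma fill_J j x : J j -> fill x j = phi (trunc j (fill x)).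
Proof.
move=> Jj; rewrite {1}/fill /= eqxx asboolT//=; congr (phi _).
by apply/trunc_eqP => i; exact: fill_upto_lt.
Qed.

Lemma fill_notJ i x : ~ J i -> fill x i = x i.
Proof. by move=> Ji; rewrite /fill /= asboolF//= fill_upto_ge. Qed.

Lemma Omega_fill n x : (1 < p)%N -> Omega J phi n (fill x).
Proof. by move=> p1; rewrite OmegaE// => j Jj _; exact: fill_J. Qed.

(** The digits outside [J] are free and determine the others: at an index of [J], both points apply
    [phi] to preceding digits that agree by induction. *)
Lemma trunc_fillP n x s : (1 < p)%N -> Omega J phi n s ->
  trunc n (fill x) = trunc n s <-> (forall i, (i < n)%N -> ~ J i -> x i = s i).
Proof.
move=> p1; elim: n => [|n ih] sJ.
  by split=> // _; apply/trunc_eqP.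
rewrite trunc_eqS ih; last exact: Omega_le sJ.
split=> [[e en] i|e].
  by rewrite ltnS leq_eqVlt => /predU1P[->{i} Ji|]; [rewrite -fill_notJ|exact: e].
have en i (lin : (i < n)%N) (Ji : ~ J i) : x i = s i by apply: e => //; exact: ltnW.
split => //; have [Jn|Jn] := pselect (J n); last by rewrite fill_notJ// e.
have [sn ->] := (OmegaS_J s p1 Jn).1 sJ; rewrite fill_J//; congr (phi _).
by apply/ih.
Qed.

Lemma fill_trunc n x y : (1 < p)%N -> trunc n x = trunc n y ->
  trunc n (fill x) = trunc n (fill y).
Proof.
move=> p1 /trunc_eqP e; apply/trunc_fillP => //; first exact: Omega_fill.
by move=> i lin Ji; rewrite fill_notJ// e.
Qed.

End Fill.

(** * Integrals over a finite partition *)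

Section Partition.
Context d (X : measurableType d) (R : realType) (K : finType).
Variables (nu : {measure set X -> \bar R}) (h : X -> K).
Hypothesis mh : forall k, measurable [set x | h x = k].

Lemma integral_partition (D : set X) (f : X -> R) :
  measurable D -> measurable_fun D f ->
  (\int[nu]_(x in D) (f x)%:E =
   \sum_(k : K) \int[nu]_(x in D `&` [set x | h x = k]) (f x)%:E)%E.
Proof.
move=> mD mf; have DE : D = \big[setU/set0]_(k <- index_enum K) (D `&` [set x | h x = k]).
  rewrite -bigcup_seq; apply/seteqP; split=> [x Dx|x [k _ []]//].
  by exists (h x) => //=; rewrite mem_index_enum.
rewrite {1}DE integral_bigsetU_EFin//.
- by move=> k; exact: measurableI.
- exact: index_enum_uniq.
- by move=> k k' _ _ [x [[_ <-] [_ <-]]].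
- by rewrite -DE; exact/measurable_EFinP.
Qed.

Lemma measure_partition (D : set X) : measurable D ->
  (nu D = \sum_(k : K) nu (D `&` [set x | h x = k]))%E.
Proof.
move=> mD; have nuE (A : set X) : measurable A -> (nu A = \int[nu]_(x in A) 1%:E)%E.
  by move=> mA; rewrite integral_cst// mul1e.
rewrite nuE// (integral_partition mD); last exact: measurable_cst.
by apply: eq_bigr => k _; rewrite -nuE//; exact: measurableI.
Qed.

Lemma integral_comp_finite (D : set X) (g : K -> R) : measurable D ->
  (\int[nu]_(x in D) (g (h x))%:E =
   \sum_(k : K) (g k)%:E * nu (D `&` [set x | h x = k]))%E.
Proof.
move=> mD; rewrite integral_partition//.
  apply: eq_bigr => k _; rewrite -integral_cst; last exact: measurableI.
  by apply: eq_integral => x /set_mem[_ /= ->].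
move=> _ Y mY; apply: measurableI => //.
have -> : (fun x => g (h x)) @^-1` Y =
  \bigcup_(k in [set k | Y (g k)]) [set x | h x = k].
  by apply/seteqP; split=> [x Yx|x [k Yk hx]]; [exists (h x)|rewrite /= hx].
by apply: fin_bigcup_measurable => //; exact: finite_finset.
Qed.

End Partition.

(** * The Borel structure of Z_p and its generation by balls *)

Section Topology.
Variable p : nat.

Lemma measurable_zp_open (A : set (Zpadic p)) : zp_open A -> measurable A.
Proof. exact: sub_sigma_algebra. Qed.

Lemma zp_open_trunc n (P : set {ffun 'I_n -> digit p}) :
  zp_open [set x | P (trunc n x)].
Proof. by move=> x Px; exists n; rewrite cylinderE /fiber => y /= ->. Qed.

Lemma measurable_trunc n (P : set {ffun 'I_n -> digit p}) :
  measurable [set x : Zpadic p | P (trunc n x)].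
Proof. by apply: measurable_zp_open; exact: zp_open_trunc. Qed.

Lemma measurable_fiber n (t : {ffun 'I_n -> digit p}) : measurable (fiber t).
Proof. exact: (measurable_trunc [set t]). Qed.

Lemma measurable_fun_trunc d (Y : measurableType d) n
    (g : {ffun 'I_n -> digit p} -> Y) (D : set (Zpadic p)) :
  measurable_fun D (fun x : Zpadic p => g (trunc n x)).
Proof.
move=> mD A mA; apply: measurableI => //.
exact: (measurable_trunc [set t | A (g t)]).
Qed.

Lemma zp_continuous_measurable (R : realType) (f : Zpadic p -> R) :
  zp_continuous f -> measurable_fun setT f.
Proof.
move=> cf; apply: (measurability _ (RGenOpens.measurableE R)).
move=> _ [_ [a [b ->]] <-]; rewrite setTI.
by apply: measurable_zp_open; apply: cf; exact: interval_open.
Qed.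

Lemma measurable_Omega (J : set nat) phi n : (1 < p)%N ->
  measurable (@Omega p J phi n).
Proof.
move=> p1.
have -> : Omega J phi n = [set x | Omega J phi n (untrunc (trunc n x))].
  apply/seteqP; split=> x; apply: Omega_trunc; rewrite ?untruncK//.
exact: (measurable_trunc [set t | Omega J phi n (untrunc t)]).
Qed.

(** The map [fill] is continuous, since the first [n] digits of [fill x] depend only on those of
    [x]. *)
Lemma measurable_fill (J : set nat) phi : (1 < p)%N ->
  measurable_fun setT (@fill p J phi).
Proof.
move=> p1; apply: (@measurability _ _ (Zpadic p) (Zpadic p) _ _ (@zp_open p)) => //.
move=> _ [U oU <-]; rewrite setTI; apply: measurable_zp_open => x Ux.
have [n] := oU _ Ux; rewrite cylinderE => nU; exists n; rewrite cylinderE => y yx.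
by apply: nU; exact: fill_trunc.
Qed.

(** The empty set is included to obtain a pi-system: two balls are either nested or disjoint. *)
Definition cylinder_system : set (set (Zpadic p)) :=
  [set A | A = set0 \/ exists n (t : {ffun 'I_n -> digit p}), A = fiber t].

Lemma cylinder_system_setI : setI_closed cylinder_system.
Proof.
move=> A B [->|[n [t ->]]]; first by rewrite set0I; left.
move=> [->|[m [s ->]]]; first by rewrite setI0; left.
wlog nm : n t m s / (n <= m)%N => [h|].
  by have [/h//|/ltnW/h] := leqP n m; rewrite setIC; exact.
have [e|ne] := pselect (trunc n (untrunc s) = t).
  right; exists m, s; apply/setIidPr => x xs; rewrite /fiber/= -e.
  by apply: trunc_eq_le nm _; rewrite untruncK.
left; apply/seteqP; split=> // x [xt xs]; apply: ne; rewrite -xt.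
by apply: trunc_eq_le nm _; rewrite untruncK.
Qed.

(** An open set is the union of the balls it contains, and there are finitely many balls at each
    level. *)
Lemma measurable_cylinder_system :
  @measurable _ (Zpadic p) = <<s cylinder_system >>.
Proof.
apply/seteqP; split; last first.
  apply: smallest_sub; first exact: sigma_algebra_measurable.
  by move=> _ [->//|[n [t ->]]]; exact: measurable_fiber.
apply: smallest_sub; first exact: smallest_sigma_algebra.
move=> A oA.
pose T n := [set t : {ffun 'I_n -> digit p} | fiber t `<=` A].
have -> : A = \bigcup_n \bigcup_(t in T n) fiber t.
  apply/seteqP; split=> [x Ax|x [n _ [t tA]]]; last exact: tA.
  by have [n] := oA _ Ax; rewrite cylinderE => nA; exists n => //; exists (trunc n x).
apply: (@bigcupT_measurable _ (g_sigma_algebraType cylinder_system)) => n.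
apply: fin_bigcup_measurable => [|t _]; first exact: finite_finset.
by apply: sub_sigma_algebra; right; exists n, t.
Qed.

End Topology.

(** * The image of Haar measure under [fill] *)

Section FillImage.
Variables (R : realType) (p : nat) (m : {measure set (Zpadic p) -> \bar R}).
Variables (J : set nat) (phi : forall j : nat, {ffun 'I_j -> digit p} -> digit p).

(** The two anonymous hypotheses are arguments so that the measure and probability structures can be
    attached to this name. *)
Definition fill_image & (1 < p)%N & m setT = 1%E : set (Zpadic p) -> \bar R :=
  pushforward m (fill J phi : Zpadic p -> Zpadic p).

HB.instance Definition _ p_gt1 m1 := Measure.copy (fill_image p_gt1 m1)
  (measure_function_pushforward__canonical__measure_function_Measure m
     (measurable_fill J phi p_gt1)).

HB.instance Definition _ p_gt1 m1 :=
  Measure_isProbability.Build _ _ _ (fill_image p_gt1 m1) m1.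

Lemma fill_probability : (1 < p)%N -> m setT = 1%E ->
  exists mu : probability (Zpadic p) R, forall A, mu A = m (fill J phi @^-1` A).
Proof. by move=> p_gt1 m1; exists (fill_image p_gt1 m1). Qed.

End FillImage.

(** * Masses of balls and of [Omega n], and singularity *)

Section Haar.
Variables (R : realType) (p : nat).
Hypothesis p_gt1 : (1 < p)%N.
Variable m : {measure set (Zpadic p) -> \bar R}.
Hypothesis m1 : m setT = 1%E.
Hypothesis mT : forall (a : Zpadic p) (A : set (Zpadic p)), measurable A ->
  m (zp_add a @` A) = m A.

Let pR_neq0 : p%:R != 0 :> R.
Proof. by rewrite pnatr_eq0 -lt0n ltnW. Qed.

Let pR_gt0 : 0 < p%:R :> R.
Proof. by rewrite ltr0n ltnW. Qed.

(** The p^n balls of level [n] are translates of one another, so they share the total mass 1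
    equally. *)
Lemma haar_fiber n (t : {ffun 'I_n -> digit p}) : m (fiber t) = (p%:R ^- n)%:E.
Proof.
pose c := m (cylinder n (fun=> ord0)).
have mc s : m (@fiber p n s) = c.
  rewrite -(untruncK s) -cylinderE -zp_add_cylinder// mT// cylinderE.
  exact: measurable_fiber.
have cfin : c \is a fin_num.
  rewrite -(mc t) ge0_fin_numE//; apply: (@le_lt_trans _ _ 1%E); last exact: ltry.
  by rewrite -m1 le_measure ?inE//; exact: measurable_fiber.
have : (m setT = \sum_(s : {ffun 'I_n -> digit p}) c)%E.
  rewrite (measure_partition m (h := trunc n)) //; last exact: measurable_fiber.
  by apply: eq_bigr => s _; rewrite setTI mc.
rewrite m1 mc -(fineK cfin) sumEFin => -[]/esym.
rewrite sumr_const card_ffun !card_ord prednK; last exact: ltnW.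
rewrite -(mulr_natr (fine c)) natrX => e; congr EFin.
by apply: (mulIf (expf_neq0 n pR_neq0)); rewrite e mulVf// expf_neq0.
Qed.

Variables (J : set nat) (phi : forall j : nat, {ffun 'I_j -> digit p} -> digit p).

Variable mu : {measure set (Zpadic p) -> \bar R}.
Hypothesis muE : forall A, mu A = m (fill J phi @^-1` A).

(** Each free digit contributes a factor 1/p to the [mu]-mass of a ball meeting [Omega n]. *)
Definition weight n : R := \prod_(i < n) (if `[< J i >] then 1 else p%:R^-1).

(** This is the Haar mass of [Omega n]: each constrained digit keeps one choice out of [p]. *)
Definition density n : R := \prod_(i < n) (if `[< J i >] then p%:R^-1 else 1).

Lemma density_weight n : density n * weight n = p%:R ^- n.
Proof.
rewrite /density /weight -big_split/= -exprVn -[in RHS](card_ord n) -prodr_const.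
by apply: eq_bigr => i _; case: ifP; rewrite ?mul1r ?mulr1.
Qed.

Lemma density_gt0 n : 0 < density n.
Proof. by apply: prodr_gt0 => i _; case: ifP => // _; rewrite invr_gt0. Qed.

Lemma fill_fiber n (t : {ffun 'I_n -> digit p}) :
  mu (fiber t) = (if `[< Omega J phi n (untrunc t) >] then weight n else 0)%:E.
Proof.
rewrite muE; case: asboolP => [tO|tO]; last first.
  rewrite (_ : _ @^-1` _ = set0) ?measure0//; apply/seteqP; split=> // x xt.
  apply: tO; apply: Omega_trunc (Omega_fill J phi n x p_gt1) => //.
  by rewrite untruncK.
(* By distributivity the weight is the sum over all strings [s] of the products of the [w i (s i)].
   Such a product is p^-n if [s] agrees with [t] outside [J], and 0 otherwise: the Haar mass of the
   part of [fiber s] that [fill] sends into [fiber t]. *)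
pose w (i : 'I_n) (d : digit p) : R :=
  if `[< J i >] || (d == t i) then p%:R^-1 else 0.
have -> : weight n = \prod_(i < n) \sum_d w i d.
  apply: eq_bigr => i _; rewrite /w; case: ifP => _ /=.
    by rewrite sumr_const card_ord prednK ?(ltnW p_gt1)// -(mulr_natr p%:R^-1) mulVf.
  by rewrite (bigD1 (t i))//= eqxx big1 ?addr0// => d /negbTE ->.
rewrite bigA_distr_bigA/= (measure_partition m (h := trunc n)); last 2 first.
- exact: measurable_fiber.
- rewrite -[X in measurable X]setTI; apply: measurable_fill => //.
  exact: measurable_fiber.
rewrite -sumEFin; apply: eq_bigr => s _; rewrite -/(fiber s).
have [sP|sP] := pselect (forall i : 'I_n, `[< J i >] || (s i == t i)).
  rewrite (_ : _ `&` _ = fiber s); last first.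
    apply/setIidPr => x xs; rewrite /fiber/= -(untruncK t); apply/trunc_fillP => //.
    move=> i lin Ji; have := sP (Ordinal lin); rewrite asboolF//= => /eqP.
    by rewrite -(untruncE t (Ordinal lin)) => /= <-; rewrite -xs ffunE.
  rewrite haar_fiber; congr EFin; rewrite -exprVn -[in LHS](card_ord n) -prodr_const.
  by apply: eq_bigr => i _; rewrite /w sP.
have [i si] : exists i : 'I_n, ~~ (`[< J i >] || (s i == t i)).
  by apply/not_existsP => h; apply: sP => i; apply/negPn/negP/h.
rewrite (bigD1 i)//= {1}/w (negbTE si) mul0r.
rewrite (_ : _ `&` _ = set0) ?measure0//; apply/seteqP; split=> // x [xt xs].
move: si; rewrite negb_or => /andP[/asboolPn Ji]; case/negP.
move: xt; rewrite /= /fiber/= -(untruncK t) => /trunc_fillP => /(_ p_gt1 tO).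
by move=> /(_ i (ltn_ord i) Ji) xi; have <- : trunc n x = s := xs; rewrite !ffunE xi.
Qed.

(** A ball of level [n] lies inside [Omega n] or misses it, so both sides are p^-n or both are 0. *)
Lemma haar_Omega_fiber n (t : {ffun 'I_n -> digit p}) :
  (m (Omega J phi n `&` fiber t) = (density n)%:E * mu (fiber t))%E.
Proof.
rewrite fill_fiber; case: asboolP => tO.
  rewrite -EFinM density_weight -(haar_fiber t); congr (m _).
  by apply/setIidPr => x xt; apply: Omega_trunc tO => //; rewrite untruncK.
rewrite mule0 (_ : _ `&` _ = set0) ?measure0//; apply/seteqP; split=> // x [xO xt].
by apply: tO; apply: Omega_trunc xO => //; rewrite untruncK.
Qed.

Lemma integral_Omega_trunc n (g : {ffun 'I_n -> digit p} -> R) :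
  (\int[m]_(x in Omega J phi n) (g (trunc n x))%:E =
   (density n)%:E * \int[mu]_x (g (trunc n x))%:E)%E.
Proof.
rewrite (integral_comp_finite m (h := trunc n)) //; last 2 first.
- exact: measurable_fiber.
- exact: measurable_Omega.
rewrite (integral_comp_finite mu (h := trunc n)) //; last exact: measurable_fiber.
under eq_bigr => t _ do rewrite -/(fiber t) haar_Omega_fiber fill_fiber -!EFinM.
under [in RHS]eq_bigr => t _ do rewrite setTI -/(fiber t) fill_fiber -EFinM.
rewrite !sumEFin -EFinM mulr_sumr; congr EFin.
by apply: eq_bigr => t _; rewrite mulrCA.
Qed.

Lemma mu_setT : mu setT = 1%E.
Proof. by rewrite muE preimage_setT. Qed.

Lemma haar_Omega n : m (Omega J phi n) = (density n)%:E.
Proof.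
have := @integral_Omega_trunc n (fun=> 1 : R).
rewrite integral_cst; last exact: measurable_Omega.
by rewrite integral_cst// !mul1e mu_setT mule1.
Qed.

(** Each element of [J] contributes a factor 1/p, at most 1/2, and no factor exceeds 1. *)
Lemma density_vanish : infinite_set J ->
  forall k, exists n, density n <= 2%:R ^- k.
Proof.
move=> Jinf; elim=> [|k [n nk]].
  by exists 0%N; rewrite /density big_ord0 expr0 invr1.
have [j nj Jj] : exists2 j, (n <= j)%N & J j.
  apply: contrapT => h; apply: Jinf; apply: (@sub_finite_set _ _ `I_n) => //.
  by move=> j Jj /=; rewrite ltnNge; apply/negP => nj; apply: h; exists j.
exists j.+1; rewrite /density big_ord_recr/= asboolT// exprS invfM [leRHS]mulrC.
rewrite -/(density j); apply: ler_pM.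
- exact/ltW/density_gt0.
- by rewrite invr_ge0 ler0n.
- apply: le_trans nk; rewrite -(subnKC nj) /density big_split_ord/=.
  rewrite -[leRHS]mulr1 ler_wpM2l//; first exact/ltW/density_gt0.
  apply: prodr_ile1 => i _; case: ifP => _; rewrite ?ler01 ?lexx// invr_ge0 ler0n/=.
  by rewrite invf_le1// ler1n ltnW.
- by rewrite lef_pV2 ?posrE ?ltr0n ?ler_nat// ltnW.
Qed.

Lemma fill_singular : infinite_set J ->
  exists A : set (Zpadic p), measurable A /\ m A = 0%E /\ mu (~` A) = 0%E.
Proof.
move=> Jinf; exists (\bigcap_n Omega J phi n).
have mA : measurable (\bigcap_n Omega J phi n).
  by apply: bigcapT_measurable => n; exact: measurable_Omega.
split=> //; split; last first.
  rewrite muE (_ : _ @^-1` _ = set0) ?measure0//; apply/seteqP; split=> // x.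
  by apply => n _; exact: Omega_fill.
apply/eqP; rewrite eq_le measure_ge0 andbT; apply/lee_addgt0Pr => e e0.
rewrite add0e; have [k ke] : exists k, 2%:R ^- k < e.
  (* Any natural number [k] above 1/e works, because k < 2^k. *)
  exists (Num.bound e^-1); rewrite -[ltRHS]invrK ltf_pV2 ?posrE ?invr_gt0 ?exprn_gt0//.
  apply: (lt_le_trans (archi_boundP _)); first by rewrite invr_ge0 ltW.
  by rewrite -natrX ler_nat ltnW// ltn_expl.
have [n nk] := density_vanish Jinf k.
apply: (@le_trans _ _ (m (Omega J phi n))).
  rewrite le_measure ?inE//; first exact: measurable_Omega.
  exact: bigcap_inf.
by rewrite haar_Omega lee_fin (le_trans nk)// ltW.
Qed.

End Haar.

(** * Uniform continuity and weak convergence *)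

(* Koenig's lemma: if the modulus failed on all of Z_p, it would fail on a
   nested sequence of balls, contradicting continuity at their intersection;
   [fill] with every digit prescribed builds that point. *)
Lemma zp_uniform_continuity (R : realType) (p : nat) (f : Zp_dig p -> R) :
  (1 < p)%N -> zp_continuous f -> forall e : R, 0 < e ->
  exists N, forall x y, trunc N x = trunc N y -> `|f x - f y| < e.
Proof.
move=> p1 cf e e0.
pose good n (t : {ffun 'I_n -> digit p}) := exists N, forall y z,
  trunc n y = t -> trunc n z = t -> trunc N y = trunc N z -> `|f y - f z| < e.
(* A ball whose [p] sub-balls all have a modulus has one too, so a bad ball [t] has a bad sub-ball,
   selected by the digit [D t]. *)
have step n : exists D : {ffun 'I_n -> digit p} -> digit p,
    forall t, ~ good n t -> forall x, trunc n x = t -> x n = D t ->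
    ~ good n.+1 (trunc n.+1 x).
  suff /choice[D DP] : forall t, exists d, ~ good n t ->
      forall x, trunc n x = t -> x n = d -> ~ good n.+1 (trunc n.+1 x) by exists D.
  move=> t.
  have [gt|ngt] := pselect (good n t); first by exists ord0.
  apply: contrapT => /forallNP h; apply: ngt.
  have {}h d : exists N, forall y z, trunc n y = t -> y n = d ->
      trunc n z = t -> z n = d -> trunc N y = trunc N z -> `|f y - f z| < e.
    apply: contrapT => h'; apply: (h d) => _ x xt xd [N xN]; apply: h'.
    exists N => y z yt yd zt zd.
    by apply: xN; apply/trunc_eqS; split; congruence.
  have [M HM] := choice h.
  (* Agreement on [n.+1] digits puts [y] and [z] in the same sub-ball, and the maximum dominates the
     modulus of that sub-ball. *)
  exists (maxn n.+1 (\max_d M d)) => y z yt zt yz.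
  have yzn : y n = z n by have /trunc_eqP := yz; apply; rewrite leq_max leqnn.
  apply: (HM (y n)) => //; apply: trunc_eq_le yz.
  by rewrite leq_max (leq_bigmax (y n)) orbT.
pose D n := sval (cid (step n)).
pose x : Zp_dig p := fill setT D (fun=> ord0).
have g0 : good 0%N (trunc 0%N x).
  apply: contrapT => bad0.
  have bad n : ~ good n (trunc n x).
    elim: n => [//|n ih].
    by apply: (svalP (cid (step n)) _ ih x) => //; rewrite /x fill_J.
  (* Continuity at [x] makes some ball around [x] good with modulus 0, against [bad]. *)
  have e2 : 0 < e / 2 by rewrite divr_gt0.
  have [n nx] := cf _ (ball_open (f x) (e / 2)) x (ballxx (f x) e2).
  apply: (bad n); exists 0%N => y z yx zx _.
  have := nx y; have := nx z; rewrite cylinderE /= => /(_ zx) fz /(_ yx) fy.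
  rewrite distrC; have -> : e = e / 2 + e / 2 by field.
  apply: ball_triangle fy; exact: ball_sym.
by case: g0 => N HN; exists N => y z yz; apply: HN => //; apply/trunc_eqP.
Qed.

(** The values of [f] stay within 1 of those at finitely many representatives of balls. *)
Lemma zp_continuous_bounded (R : realType) (p : nat) (f : Zp_dig p -> R) :
  (1 < p)%N -> zp_continuous f -> exists M, forall x, `|f x| <= M.
Proof.
move=> p1 cf; have [N HN] := zp_uniform_continuity p1 cf ltr01.
exists (1 + \sum_(t : {ffun 'I_N -> digit p}) `|f (untrunc t)|) => x.
have -> : f x = (f x - f (untrunc (trunc N x))) + f (untrunc (trunc N x)) by ring.
apply: (le_trans (ler_normD _ _)); apply: lerD.
  by apply/ltW/HN; rewrite untruncK.
by rewrite (bigD1 (trunc N x))//= lerDl sumr_ge0.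
Qed.

Section FiniteMeasure.
Context d (X : measurableType d) (R : realType) (nu : {measure set X -> \bar R}).
Hypothesis nu1 : nu setT = 1%E.

Lemma bounded_integrable (D : set X) (h : X -> R) (M : R) : measurable D ->
  measurable_fun D h -> (forall x, `|h x| <= M) ->
  nu.-integrable D (EFin \o h).
Proof.
move=> mD mh hM; apply: measurable_bounded_integrable => //.
  apply: (@le_lt_trans _ _ (nu setT)); last by rewrite nu1 ltry.
  by rewrite le_measure ?inE.
by exists M; split; [exact: num_real|move=> y My x _ /=; exact: le_trans (ltW My)].
Qed.

Lemma Rintegral_dist (D : set X) (h k : X -> R) (c : R) : measurable D ->
  nu.-integrable D (EFin \o h) -> nu.-integrable D (EFin \o k) ->
  (forall x, `|h x - k x| <= c) ->
  `|\int[nu]_(x in D) h x - \int[nu]_(x in D) k x| <= c * fine (nu D).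
Proof.
move=> mD ih ik hk; rewrite -RintegralB//.
have ihk : nu.-integrable D (EFin \o (fun x => h x - k x)).
  by apply: eq_integrable (integrableB mD ih ik) => // x _; rewrite /= EFinB.
apply: (le_trans (le_normr_Rintegral mD ihk)).
rewrite -Rintegral_cst//; apply: le_Rintegral => //.
  by apply: eq_integrable (integrable_abse ihk).
apply: (bounded_integrable (M := `|c|)) => //; exact: measurable_cst.
Qed.

End FiniteMeasure.

(** Past the modulus [N], [f] is within e/2 of the function [fg] of the first [g] digits, whose
    average over [Omega g] equals its [mu]-integral exactly. *)
Lemma fill_weak_limit (R : realType) (p : nat) (p_gt1 : (1 < p)%N)
    (m mu : {measure set (Zpadic p) -> \bar R}) (J : set nat)
    (phi : forall j : nat, {ffun 'I_j -> digit p} -> digit p) (f : Zpadic p -> R) :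
  m setT = 1%E ->
  (forall (a : Zpadic p) (A : set (Zpadic p)), measurable A ->
    m (zp_add a @` A) = m A) ->
  (forall A, mu A = m (fill J phi @^-1` A)) ->
  zp_continuous f ->
  (fun g : nat => fine (\int[m]_(x in Omega J phi g) (f x)%:E)%E
                  / fine (m (Omega J phi g)))
    @ \oo --> fine (\int[mu]_x (f x)%:E)%E.
Proof.
move=> m1 mT muE cf.
have mu1 : mu setT = 1%E := mu_setT m1 muE.
have mOm g : measurable (Omega J phi g) := measurable_Omega J phi g p_gt1.
have mf := zp_continuous_measurable cf.
have [M fM] := zp_continuous_bounded p_gt1 cf.
apply/cvgrPdist_le => e e0; have e2 : 0 < e / 2 by rewrite divr_gt0.
have [N HN] := zp_uniform_continuity p_gt1 cf e2.
near=> g; have Ng : (N <= g)%N by near: g; exact: nbhs_infty_ge.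
pose fg (x : Zpadic p) := f (untrunc (trunc g x)).
have ffg x : `|f x - fg x| <= e / 2.
  by apply/ltW/HN; apply: trunc_eq_le Ng _; rewrite untruncK.
have mfg D : measurable_fun D fg.
  exact: (@measurable_fun_trunc _ _ _ _ (fun t => f (untrunc t))).
have fgM x : `|fg x| <= M by exact: fM.
have mfD D : measurable_fun D f by exact: measurable_funTS.
have h1 := Rintegral_dist m1 (mOm g) (bounded_integrable m1 (mOm g) (mfD _) fM)
  (bounded_integrable m1 (mOm g) (mfg _) fgM) ffg.
have h2 := Rintegral_dist mu1 measurableT (bounded_integrable mu1 measurableT mf fM)
  (bounded_integrable mu1 measurableT (mfg _) fgM) ffg.
have fgfin : (\int[mu]_x (fg x)%:E \is a fin_num)%E.
  apply: (integrable_fin_num measurableT).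
  exact: (bounded_integrable mu1 measurableT (mfg _) fgM).
have eO : (\int[m]_(x in Omega J phi g) fg x = density R p J g * \int[mu]_x fg x).
  rewrite /Rintegral (integral_Omega_trunc p_gt1 m1 mT muE (fun t => f (untrunc t))).
  by rewrite fineM.
move: h1 h2; rewrite eO mu1 (haar_Omega p_gt1 m1 mT muE) /= mulr1.
rewrite -/(Rintegral m _ f) -/(Rintegral mu _ f).
have d0 := density_gt0 R p_gt1 J g.
set A := Rintegral m _ _; set B := Rintegral mu _ fg; set C := Rintegral mu _ f.
move: (density _ _ _ _) d0 => c c0 h1 h2.
(* The error over [Omega g] is at most e/2 times its mass [c], and normalization divides by [c]. *)
have h3 : `|A / c - B| <= e / 2.
  have -> : A / c - B = (A - c * B) / c.
    by rewrite mulrBl [c * B]mulrC mulfK ?gt_eqF.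
  by rewrite normrM normfV (gtr0_norm c0) ler_pdivrMr.
have -> : C - A / c = (C - B) - (A / c - B) by ring.
apply: (le_trans (ler_normB _ _)); have -> : e = e / 2 + e / 2 by field.
exact: lerD.
Unshelve. all: by end_near.
Qed.

(** * Periodicity of cosine and sine, and sums invariant under a rotation *)

Section Trig.
Variable R : realType.

Let cosin2piDnat (a : R) (n : nat) :
  cos (2 * pi * (a + n%:R)) = cos (2 * pi * a) /\
  sin (2 * pi * (a + n%:R)) = sin (2 * pi * a).
Proof.
elim: n => [|n [ihc ihs]]; first by rewrite addr0.
have -> : 2 * pi * (a + n.+1%:R) = 2 * pi * (a + n%:R) + pi *+ 2.
  by rewrite -natr1 -mulr_natr; ring.
by rewrite cosD2pi sinD2pi.
Qed.

Lemma cos2piDint (a : R) (k : int) :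
  cos (2 * pi * (a + k%:~R)) = cos (2 * pi * a).
Proof.
case: k => n; first by rewrite -pmulrn; have [] := cosin2piDnat a n.
by have [<- _] := cosin2piDnat (a + (Negz n)%:~R) n.+1; rewrite NegzE mulrNz subrK.
Qed.

Lemma sin2piDint (a : R) (k : int) :
  sin (2 * pi * (a + k%:~R)) = sin (2 * pi * a).
Proof.
case: k => n; first by rewrite -pmulrn; have [] := cosin2piDnat a n.
by have [_ <-] := cosin2piDnat (a + (Negz n)%:~R) n.+1; rewrite NegzE mulrNz subrK.
Qed.

(** The value is 1 - 2 sin^2(pi |a|), and pi |a| lies strictly between 0 and pi. *)
Lemma cos2pi_neq1 (a : R) : 0 < `|a| -> `|a| < 1 -> cos (2 * pi * a) != 1.
Proof.
move=> a0 a1; have pi0 := pi_gt0 R.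
have -> : cos (2 * pi * a) = cos ((pi * `|a|) *+ 2).
  rewrite -cos_norm normrM (gtr0_norm (mulr_gt0 _ _))//.
  by congr cos; rewrite -mulr_natr; ring.
have := @sin_gt0_pi _ (pi * `|a|).
rewrite mulr_gt0//= -[ltRHS]mulr1 ltr_pM2l// a1 => /(_ isT) s0.
rewrite cos_mulr2n cos2sin2 lt_eqF//.
have : 0 < sin (pi * `|a|) ^+ 2 by rewrite exprn_gt0.
by rewrite -mulr_natr; set s := sin _ ^+ 2; lra.
Qed.

(* The reindexing [tau] multiplies the sum of the [exp (2 pi i h t)] by
   [exp (2 pi i alpha)], which differs from 1. *)
Lemma rotation_sum0 (T : finType) (P : pred T) (h : T -> R) (tau : T -> T)
    (alpha : R) :
  injective tau -> (forall t, P (tau t) = P t) ->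
  (forall t, P t -> exists k : int, h (tau t) = h t + alpha + k%:~R) ->
  cos (2 * pi * alpha) != 1 ->
  \sum_(t | P t) cos (2 * pi * h t) = 0 /\
  \sum_(t | P t) sin (2 * pi * h t) = 0.
Proof.
move=> tauI tauP htau alpha1.
set C := \sum_(t | P t) cos _; set S := \sum_(t | P t) sin _.
set c := cos (2 * pi * alpha) in alpha1 *; pose s := sin (2 * pi * alpha).
(* [eC] and [eS] are the real and imaginary parts of C + iS = (C + iS)(c + is). *)
have eC : C = C * c - S * s.
  rewrite {1}/C (reindex_inj tauI)/= !mulr_suml -sumrB.
  apply: eq_big => [t|t]; first exact: tauP.
  by rewrite tauP => /htau[k ->]; rewrite cos2piDint mulrDr cosD.
have eS : S = S * c + C * s.
  rewrite {1}/S (reindex_inj tauI)/= !mulr_suml -big_split/=.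
  apply: eq_big => [t|t]; first exact: tauP.
  by rewrite tauP => /htau[k ->]; rewrite sin2piDint mulrDr sinD.
have cs : c ^+ 2 + s ^+ 2 = 1 by exact: cos2Dsin2.
(* The linear system [eC], [eS] in C and S has determinant (1 - c)^2 + s^2 = 2(1 - c). *)
have c1 : 2 * (1 - c) != 0 by rewrite mulf_neq0// subr_eq0 eq_sym.
split; apply: (mulfI c1); rewrite mulr0.
  have -> : 2 * (1 - c) * C = (1 - c) * (C - (C * c - S * s))
    - s * (S - (S * c + C * s)) + (1 - (c ^+ 2 + s ^+ 2)) * C by ring.
  by rewrite -eC -eS cs !subrr !mulr0 mul0r subr0 addr0.
have -> : 2 * (1 - c) * S = (1 - c) * (S - (S * c + C * s))
    + s * (C - (C * c - S * s)) + (1 - (c ^+ 2 + s ^+ 2)) * S by ring.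
by rewrite -eC -eS cs !subrr !mulr0 mul0r !addr0.
Qed.

End Trig.

(** * Elements of Z[1/p] and the phases of their characters *)

Definition pfrac (F : numFieldType) (p : nat) (c : nat -> int) (n : nat) : F :=
  \sum_(i < n) (c i)%:~R / p%:R ^+ i.+1.

Section Pfrac.
Variables (F : numFieldType) (p : nat).
Hypothesis p_gt1 : (1 < p)%N.
Implicit Types (c : nat -> int) (x y : Zp_dig p).

Let pF_neq0 : p%:R != 0 :> F.
Proof. by rewrite pnatr_eq0 -lt0n ltnW. Qed.

Lemma pfracS c n : pfrac F p c n.+1 = pfrac F p c n + (c n)%:~R / p%:R ^+ n.+1.
Proof. by rewrite /pfrac big_ord_recr. Qed.

Lemma pfrac_widen c m n : (m <= n)%N -> (forall i, (m <= i)%N -> c i = 0) ->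
  pfrac F p c n = pfrac F p c m.
Proof.
move=> /subnKC <- c0; elim: (n - m)%N => [|k ih]; first by rewrite addn0.
by rewrite addnS pfracS ih c0 ?leq_addr// mul0r addr0.
Qed.

(** Coefficients are integers rather than digits because differences of elements of [Lambda] also
    have negative ones. *)
Lemma pfracB c c' n :
  pfrac F p c n - pfrac F p c' n = pfrac F p (fun i => c i - c' i) n.
Proof. by rewrite /pfrac -sumrB; apply: eq_bigr => i _; rewrite -mulrBl intrB. Qed.

Lemma pfrac_int c n : exists k : int, pfrac F p c n * p%:R ^+ n = k%:~R.
Proof.
elim: n => [|n [k ih]]; first by exists 0; rewrite /pfrac big_ord0 mul0r.
exists (k * p%:Z + c n); rewrite pfracS mulrDl divfK ?expf_neq0//.
by rewrite exprSr mulrA ih intrD intrM.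
Qed.

Lemma zval_split m n x : (m <= n)%N ->
  exists w : nat, zval n x = (zval m x + w * p ^ m)%N.
Proof.
move=> mn; exists (zval n x %/ p ^ m)%N.
by rewrite -(zval_mod p_gt1 x mn) addnC -divn_eq.
Qed.

(** Multiplication by p^m clears the denominators, so the digits of [x] of index at least [m]
    contribute an integer. *)
Lemma pfrac_zval c m n x : (m <= n)%N -> exists k : int,
  pfrac F p c m * (zval n x)%:R = pfrac F p c m * (zval m x)%:R + k%:~R.
Proof.
move=> mn; have [w ->] := zval_split x mn; have [k ek] := pfrac_int c m.
exists (k * w%:Z); rewrite natrD mulrDr natrM natrX; congr (_ + _).
by rewrite [w%:R * _]mulrC mulrA ek intrM.
Qed.

End Pfrac.

(** [phase] works with the reduced denominator p^M, where M <= n. Dropping the digits of [x] from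
    [M] on and reducing modulo the denominator each change the value by an integer, which cosine and
    sine do not see. *)
Lemma phase_pfrac (R : realType) (p : nat) (c : nat -> int) (n : nat)
    (x : Zp_dig p) : prime p ->
  exists k : int, phase R (pfrac rat p c n) x =
    pfrac R p c n * (zval n x)%:R + k%:~R.
Proof.
move=> pp; have p1 := prime_gt1 pp; set l := pfrac rat p c n.
have -> : pfrac R p c n = ratr l.
  rewrite rmorph_sum; apply: eq_bigr => i _.
  by rewrite fmorph_div/= rmorph_int rmorphXn/= rmorph_nat.
have [A eA] := pfrac_int rat p1 c n.
have dvd : (`|denq l| %| p ^ n)%N.
  have : (`|denq l| %| `|numq l| * p ^ n)%N.
    have e : numq l * (p ^ n)%:Z = A * denq l.
      apply: (@intr_inj rat); rewrite !intrM numqE -eA mulrAC; congr (_ * _ * _).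
      by rewrite -pmulrn natrX.
    by apply/dvdnP; exists `|A|%N; rewrite -abszM -e abszM.
  by rewrite Gauss_dvdr// coprime_sym coprime_num_den.
have [M Mn dM] : exists2 M, (M <= n)%N & `|denq l|%N = (p ^ M)%N.
  by apply/dvdn_pfactor.
rewrite /phase dM pfactorK//.
have dE : denq l = (p ^ M)%:Z by rewrite -dM gez0_abs// denq_ge0.
have d0 : (denq l)%:~R != 0 :> R by rewrite intr_eq0 denq_neq0.
have [w ->] := zval_split p1 x Mn.
set z := zval M x; set a := numq l * z%:Z.
exists (- (a %/ denq l)%Z - numq l * w%:Z).
have -> : (a %% denq l)%Z = a - (a %/ denq l)%Z * denq l.
  by rewrite {2}(divz_eq a (denq l)); ring.
have pM : (p ^ M)%:R = (denq l)%:~R :> R by rewrite dE.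
rewrite natrD natrM pM /ratr; move: (a %/ denq l)%Z => q.
rewrite /a !(intrB, intrM, intrN) -!pmulrn; move: d0.
by move: (denq l)%:~R (numq l)%:~R => d b d0; field.
Qed.

(** * Vanishing sums obtained from cyclic digit shifts *)

Definition bump_digit (p n : nat) (i : 'I_n) (t : {ffun 'I_n -> digit p}) :
  {ffun 'I_n -> digit p} := [ffun j => if j == i then ordS (t j) else t j].

Lemma bump_digit_inj p n (i : 'I_n) : injective (@bump_digit p n i).
Proof.
move=> t s /ffunP e; apply/ffunP => j; have := e j; rewrite !ffunE.
by case: ifP => // _; exact: ordS_inj.
Qed.

(** The integer [e] is -1 when the digit wraps around to 0, and 0 otherwise. *)
Lemma ordS_int p (d : digit p) : (0 < p)%N ->
  exists e : int, (ordS d : nat)%:Z = d%:Z + 1 + p%:Z * e.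
Proof.
move=> p0; exists (- (d.+1 %/ p)%N%:Z) => /=.
have -> : (d.+1 %% p.-1.+1 = d.+1 %% p)%N by congr (_ %% _)%N; rewrite prednK.
have e := divn_eq d.+1 p.
have {}e : d%:Z + 1 = (d.+1 %/ p)%N%:Z * p%:Z + (d.+1 %% p)%N%:Z by lia.
by rewrite e; ring.
Qed.

Section Orthogonality.
Variables (R : realType) (p : nat).
Hypothesis p_gt1 : (1 < p)%N.

Let p_gt0 : (0 < p)%N. Proof. exact: ltnW. Qed.

Let pR_neq0 : p%:R != 0 :> R.
Proof. by rewrite pnatr_eq0 -lt0n. Qed.

Lemma cos_div_p_neq1 (c : int) : c != 0 -> `|c| < p%:Z ->
  cos (2 * pi * (c%:~R / p%:R)) != 1 :> R.
Proof.
move=> c0 cp; apply: cos2pi_neq1; rewrite normrM normfV (ger0_norm (ler0n R p)).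
  by rewrite divr_gt0 ?ltr0n// normr_gt0 intr_eq0.
by rewrite ltr_pdivrMr ?ltr0n// mul1r -intr_norm pmulrn ltr_int.
Qed.

Lemma zval_bump_last n (t : {ffun 'I_n.+1 -> digit p}) : exists e : int,
  (zval n.+1 (untrunc (bump_digit ord_max t)))%:R =
  (zval n.+1 (untrunc t))%:R + p%:R ^+ n * (1 + p%:R * e%:~R) :> R.
Proof.
have [e ee] := ordS_int (t ord_max) p_gt0; exists e.
rewrite !zvalS !natrD !natrM !natrX.
have -> : zval n (untrunc (bump_digit ord_max t)) = zval n (untrunc t).
  apply: eq_bigr => i _; have := untruncE t (widen_ord (leqnSn n) i).
  have := untruncE (bump_digit ord_max t) (widen_ord (leqnSn n) i).
  by rewrite /= => -> ->; rewrite ffunE -val_eqE /= ltn_eqF.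
have := untruncE (bump_digit ord_max t) ord_max; have := untruncE t ord_max.
rewrite /= => -> ->; rewrite ffunE eqxx.
have {}ee : (ordS (t ord_max))%:R = (t ord_max)%:R + 1 + p%:R * e%:~R :> R.
  by rewrite !pmulrn ee !(intrD, intrM).
by rewrite ee; ring.
Qed.

(** At level [n.+1] digit [n] is free, and the constraints of smaller index read only digits before
    it. *)
Lemma Omega_bump_last (J : set nat) phi n (t : {ffun 'I_n.+1 -> digit p}) :
  ~ J n -> `[< Omega J phi n.+1 (untrunc (bump_digit ord_max t)) >] =
           `[< Omega J phi n.+1 (untrunc t) >].
Proof.
move=> Jn; apply: asbool_equiv_eq.
have e : trunc n (untrunc (bump_digit ord_max t)) = trunc n (untrunc t).
  apply/ffunP => i; rewrite !ffunE; have := untruncE t (widen_ord (leqnSn n) i).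
  have := untruncE (bump_digit ord_max t) (widen_ord (leqnSn n) i).
  by rewrite /= => -> ->; rewrite ffunE -val_eqE /= ltn_eqF.
rewrite !OmegaS_notJ//; split; exact: Omega_trunc.
Qed.

(** Shifting digit [n] adds p^n modulo p^(n+1), which changes [h] by c_n/p up to an integer: the
    coefficients of index below [n] become integers when multiplied by p^n. *)
Lemma orthogonal_sum (J : set nat) phi n (c : nat -> int) :
  ~ J n -> c n != 0 -> `|c n| < p%:Z ->
  let h (t : {ffun 'I_n.+1 -> digit p}) :=
    pfrac R p c n.+1 * (zval n.+1 (untrunc t))%:R in
  \sum_(t | `[< Omega J phi n.+1 (untrunc t) >]) cos (2 * pi * h t) = 0 /\
  \sum_(t | `[< Omega J phi n.+1 (untrunc t) >]) sin (2 * pi * h t) = 0.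
Proof.
move=> Jn c0 cp h.
apply: (rotation_sum0 (@bump_digit_inj _ _ _) _ _ (cos_div_p_neq1 c0 cp)).
  by move=> t; exact: Omega_bump_last.
move=> t _; have [e ee] := zval_bump_last t; have [k ek] := pfrac_int R p_gt1 c n.
exists (c n * e + k * (1 + p%:Z * e)).
rewrite /h ee pfracS !(intrD, intrM) -ek -pmulrn exprS.
have := expf_neq0 n pR_neq0; have := pR_neq0.
set z := (zval n.+1 _)%:R.
move: (pfrac _ _ _ _) z (p%:R ^+ n : R) (p%:R : R) => P z q r r0 q0.
by field; rewrite r0 q0.
Qed.

(** The roles of points and frequencies are exchanged. Since x - s is p^i (D + p r) with [r] an
    integer and 0 < |D| < p, raising coefficient [i] by 1 changes [h] by D/p up to an integer. *)
Lemma dual_orthogonal_sum (J : set nat) N (x s : Zp_dig p) (i : 'I_N) :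
  ~ J i -> trunc i x = trunc i s -> x i != s i ->
  let h (b : {ffun 'I_N -> digit p}) :=
    pfrac R p (fun k => untrunc b k) N * ((zval N x)%:R - (zval N s)%:R) in
  let P (b : {ffun 'I_N -> digit p}) := [forall k : 'I_N, `[< J k >] ==> (b k == ord0)] in
  \sum_(b | P b) cos (2 * pi * h b) = 0 /\
  \sum_(b | P b) sin (2 * pi * h b) = 0.
Proof.
move=> Ji xs xsi h P; pose D : int := (x i)%:Z - (s i)%:Z.
have D0 : D != 0 by rewrite subr_eq0 eqz_nat.
have Dp : `|D| < p%:Z by have := digit_lt p_gt1 (x i); have := digit_lt p_gt1 (s i); lia.
apply: (rotation_sum0 (@bump_digit_inj _ _ i) _ _ (cos_div_p_neq1 D0 Dp)) => b.
  apply: eq_forallb => k; rewrite ffunE; case: ifP => // /eqP ->.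
  by rewrite asboolF.
move=> _; have [e ee] := ordS_int (b i) p_gt0.
have [w ew] := zval_split p_gt1 x (ltn_ord i).
have [v ev] := zval_split p_gt1 s (ltn_ord i).
exists (e * (D + p%:Z * (w%:Z - v%:Z)) + (w%:Z - v%:Z)).
rewrite /h; set y := zval N x in ew *; set z := zval N s in ev *.
have -> : pfrac R p (fun k => untrunc (bump_digit i b) k) N =
    pfrac R p (fun k => untrunc b k) N + (1 + p%:R * e%:~R) / p%:R ^+ i.+1.
  rewrite /pfrac (bigD1 i)//= [in RHS](bigD1 i)//= !untruncE ffunE eqxx ee.
  rewrite !(intrD, intrM) -!pmulrn.
  under eq_bigr => k ki do rewrite untruncE ffunE (negbTE ki).
  under [in RHS]eq_bigr => k ki do rewrite untruncE.
  by rewrite -!addrA mulrDl -!addrA; congr (_ + _); rewrite addrC.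
have -> : y%:R - z%:R = p%:R ^+ i * (D%:~R + p%:R * (w%:R - v%:R)) :> R.
  rewrite ew ev !zvalS (zval_trunc xs) /D !natrD !natrM expnS !natrM.
  rewrite !natrX intrB -!pmulrn.
  by ring.
rewrite !(intrD, intrM, intrB) -!pmulrn exprS.
have := expf_neq0 i pR_neq0; have := pR_neq0.
move: (pfrac _ _ _ _) (p%:R ^+ i : R) (p%:R : R) => Q q r r0 q0.
by field; rewrite r0 q0.
Qed.

End Orthogonality.

(** Any large [n] is allowed as number of terms, so two elements can be written at a common
    level. *)
Lemma Lambda_pfrac (p : nat) (I : set nat) (l : rat) : Lambda p I l ->
  exists (b : nat -> nat) (N : nat),
    [/\ forall i, (b i < p)%N, forall i, b i != 0%N -> I i,
        forall i, (N <= i)%N -> b i = 0%N &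
        forall n, (N <= n)%N -> l = pfrac rat p (fun i => b i) n].
Proof.
move=> [b [N [bp [bI ->]]]]; exists b, N.
have b0 i : (N <= i)%N -> b i = 0%N.
  by move=> Ni; apply: contraTeq Ni => /bI[_]; rewrite ltnNge.
split=> // [i /bI[]//|n Nn].
by rewrite (@pfrac_widen rat p _ N n)// => i /b0 ->.
Qed.

(** * Square integrable functions tested on balls *)

Section PartitionLinear.
Context d (X : measurableType d) (R : realType) (K : finType).
Variables (nu : {measure set X -> \bar R}) (h : X -> K).
Hypothesis mh : forall k, measurable [set x | h x = k].

(** With [g1] and [g2] the cosine and sine of a character of finite level, this turns an
    orthogonality relation into a finite linear one between integrals of [u] and [v] over balls. *)
Lemma integral_comp_finite_lin (u v : X -> R) (g1 g2 : K -> R) :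
  nu.-integrable setT (EFin \o u) -> nu.-integrable setT (EFin \o v) ->
  measurable_fun setT (fun x => g1 (h x)) ->
  measurable_fun setT (fun x => g2 (h x)) ->
  (\int[nu]_x (u x * g1 (h x) + v x * g2 (h x))%:E =
   (\sum_k (Rintegral nu [set x | h x = k] u * g1 k +
            Rintegral nu [set x | h x = k] v * g2 k))%:E)%E.
Proof.
move=> iu iv mg1 mg2.
have /measurable_EFinP mu := measurable_int _ iu.
have /measurable_EFinP mv := measurable_int _ iv.
rewrite (integral_partition nu mh)//; last first.
  by apply: measurable_funD; apply: measurable_funM.
rewrite -sumEFin; apply: eq_bigr => k _; rewrite setTI.
have iuk : nu.-integrable [set x | h x = k] (EFin \o u) by exact: integrableS iu.
have ivk : nu.-integrable [set x | h x = k] (EFin \o v) by exact: integrableS iv.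
transitivity (\int[nu]_(x in [set x | h x = k]) ((u x * g1 k)%:E + (v x * g2 k)%:E))%E.
  by apply: eq_integral => x /set_mem /= ->.
rewrite integralD//.
- under eq_integral do rewrite EFinM.
  under [X in (_ + X)%E]eq_integral do rewrite EFinM.
  rewrite !integralZr// EFinD !EFinM /Rintegral !fineK//; exact: integrable_fin_num.
- by apply: eq_integrable (integrableZr _ (g1 k) iuk) => // x _; rewrite /= EFinM.
- by apply: eq_integrable (integrableZr _ (g2 k) ivk) => // x _; rewrite /= EFinM.
Qed.

End PartitionLinear.

Lemma integrable_sqr_integrable d (X : measurableType d) (R : realType)
    (nu : {measure set X -> \bar R}) (u : X -> R) : nu setT = 1%E ->
  measurable_fun setT u -> nu.-integrable setT (fun x => (u x ^+ 2)%:E) ->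
  nu.-integrable setT (EFin \o u).
Proof.
move=> nu1 mu iu2.
have i1 : nu.-integrable setT (EFin \o (fun=> 1 : R)).
  by apply: (bounded_integrable nu1 (M := 1)) => // x; rewrite normr1.
have := integrableD measurableT i1 iu2; apply: le_integrable => //.
  exact/measurable_EFinP.
move=> x _ /=; rewrite lee_fin [leRHS]ger0_norm; last by rewrite addr_ge0// sqr_ge0.
(* From (|u| - 1/2)^2 >= 0 follows |u| <= u^2 + 1/4. *)
by rewrite -real_normK ?num_real//; have := sqr_ge0 (`|u x| - 2^-1); nra.
Qed.

(** The measurable sets over which [u] has integral 0 form a Dynkin system; containing the pi-system
    of balls, it contains every measurable set. *)
Lemma ae_eq0_cylinder (R : realType) (p : nat)
    (nu : {measure set (Zpadic p) -> \bar R}) (u : Zpadic p -> R) :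
  nu.-integrable setT (EFin \o u) ->
  (forall n (t : {ffun 'I_n -> digit p}), \int[nu]_(x in fiber t) (u x)%:E = 0)%E ->
  {ae nu, forall x, u x = 0}.
Proof.
move=> iu u0; have mu := measurable_int _ iu.
(* The whole space is the only ball of level 0. *)
have uT : (\int[nu]_x (u x)%:E = 0)%E.
  rewrite -(u0 0%N [ffun=> ord0]); congr (integral _ _ _).
  by apply/seteqP; split=> // x _; apply/ffunP => -[].
have uA (A : set (Zpadic p)) : measurable A -> (\int[nu]_(x in A) (u x)%:E = 0)%E.
  rewrite measurable_cylinder_system.
  apply: (dynkin_induction (P := fun A => \int[nu]_(x in A) (u x)%:E = 0)%E
    (measurable_cylinder_system p) (@cylinder_system_setI p)) => //.
  - by move=> _ [->|[n [t ->]]]; [rewrite integral_set0|exact: u0].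
  - move=> S mS uS; move: uT; rewrite -(setUv S) integral_setU_EFin//.
    + by rewrite uS add0e.
    + exact: measurableC.
    + by rewrite setUv; exact/measurable_EFinP.
    + by rewrite disj_set2E setICr.
  - move=> F mF tF uF; rewrite integral_bigcup//.
      by rewrite eseries0.
    by apply: integrableS iu => //; exact: bigcupT_measurable.
have := @integral_ae_eq _ _ _ nu setT measurableT (cst 0%E) _ iu (measurable_cst _).
have h E : E `<=` setT -> measurable E ->
    (\int[nu]_(x in E) (EFin \o u) x = \int[nu]_(x in E) cst 0 x)%E.
  by move=> _ mE; rewrite uA// integral0.
by move=> /(_ h); apply: filterS => x /(_ I) [].
Qed.

(** * Orthonormality and completeness of the characters *)

Section Spectrum.
Variables (R : realType) (p : nat) (I J : set nat).
Variable phi : forall j : nat, {ffun 'I_j -> digit p} -> digit p.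
Variables m mu : {measure set (Zpadic p) -> \bar R}.
Hypothesis p_prime : prime p.
Hypothesis IJ0 : I `&` J = set0.
Hypothesis IJT : I `|` J = setT.
Hypothesis m1 : m setT = 1%E.
Hypothesis mT : forall (a : Zpadic p) (A : set (Zpadic p)), measurable A ->
  m (zp_add a @` A) = m A.
Hypothesis muE : forall A, mu A = m (fill J phi @^-1` A).

Let p_gt1 : (1 < p)%N. Proof. exact: prime_gt1. Qed.

Let mu1 : mu setT = 1%E := mu_setT m1 muE.

Let notJ_I i : ~ J i -> I i.
Proof. by move=> Ji; have : setT i by []; rewrite -IJT => -[]. Qed.

Let I_notJ i : I i -> ~ J i.
Proof. by move=> Ii Ji; have : (I `&` J) i by []; rewrite IJ0. Qed.

Lemma integral_fill_trunc n (g : {ffun 'I_n -> digit p} -> R) :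
  (\int[mu]_x (g (trunc n x))%:E =
   (weight R p J n * \sum_(t | `[< Omega J phi n (untrunc t) >]) g t)%:E)%E.
Proof.
rewrite (integral_comp_finite mu (h := trunc n))//; last exact: measurable_fiber.
rewrite mulr_sumr [in RHS]big_mkcond/= -sumEFin; apply: eq_bigr => t _.
rewrite setTI -/(fiber t) (fill_fiber p_gt1 m1 mT muE) -EFinM.
by case: ifP => _; rewrite ?mulr0// mulrC.
Qed.

Lemma fill_orthonormal (l l' : rat) : Lambda p I l -> Lambda p I l' ->
  (\int[mu]_x (cos (2 * pi * (phase R l x - phase R l' x)))%:E
    = (if l == l' then 1 else 0)%:E)%E /\
  (\int[mu]_x (sin (2 * pi * (phase R l x - phase R l' x)))%:E = 0)%E.
Proof.
move=> Ll Ll'; case: eqVneq => [<-|ll'].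
  under eq_integral do rewrite subrr mulr0 cos0.
  under [X in _ /\ X = _]eq_integral do rewrite subrr mulr0 sin0.
  by rewrite !integral_cst// mu1 mul1e mul0e.
have [b [N [bp bI b0 lE]]] := Lambda_pfrac Ll.
have [b' [N' [bp' bI' b0' lE']]] := Lambda_pfrac Ll'.
pose c i : int := (b i)%:Z - (b' i)%:Z.
pose M := maxn N N'.
have c0 i : (M <= i)%N -> c i = 0.
  by rewrite geq_max => /andP[/b0 bi /b0' bi']; rewrite /c bi bi' subrr.
(* [n] is the last index where the coefficients differ. With none after it, the difference of phases
   depends, modulo integers, on [n.+1] digits only. *)
have [n [cn cn0]] : exists n, c n != 0 /\ forall i, (n < i)%N -> c i = 0.
  have ex : exists i, c i != 0.
    apply: contrapT => /forallNP h; move/eqP: ll'; apply.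
    rewrite (lE M) ?leq_maxl// (lE' M) ?leq_maxr//.
    apply/eqP; rewrite -subr_eq0 pfracB /pfrac big1// => i _.
    by have /negP/negPn/eqP := h i; rewrite /c => ->; rewrite mul0r.
  have ub i : c i != 0 -> (i <= M)%N.
    by apply: contraR; rewrite -ltnNge => /ltnW/c0 ->; rewrite eqxx.
  case: (ex_maxnP ex ub) => n cn nmax; exists n; split=> // i ni.
  by apply: contraTeq ni => /nmax; rewrite -leqNgt.
have nM : (n < M)%N.
  by rewrite ltnNge; apply: contra cn => /c0 ->.
have In : I n.
  have [bn|bn] := eqVneq (b n) 0%N; last exact: bI.
  by apply: bI'; apply: contraNneq cn => bn'; rewrite /c bn bn'.
have cp : `|c n| < p%:Z by have := bp n; have := bp' n; rewrite /c; lia.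
have [sC sS] := orthogonal_sum R p_gt1 phi (I_notJ In) cn cp.
pose h (t : {ffun 'I_n.+1 -> digit p}) :=
  pfrac R p c n.+1 * (zval n.+1 (untrunc t))%:R.
have hE x : exists k : int, phase R l x - phase R l' x = h (trunc n.+1 x) + k%:~R.
  rewrite (lE M) ?leq_maxl// (lE' M) ?leq_maxr//.
  have [k ->] := phase_pfrac R (fun i => b i) M x p_prime.
  have [k' ->] := phase_pfrac R (fun i => b' i) M x p_prime.
  have e : pfrac R p (fun i => b i) M - pfrac R p (fun i => b' i) M = pfrac R p c n.+1.
    by rewrite pfracB; exact: pfrac_widen.
  have [k0 ek0] := pfrac_zval R p_gt1 c x nM.
  exists (k0 + k - k').
  have -> : h (trunc n.+1 x) = pfrac R p c n.+1 * (zval n.+1 x)%:R.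
    by rewrite /h; congr (_ * _%:R); apply: zval_trunc; rewrite untruncK.
  rewrite intrB intrD addrA addrA -ek0 -e; ring.
split.
  transitivity (\int[mu]_x (cos (2 * pi * h (trunc n.+1 x)))%:E)%E.
    by apply: eq_integral => x _; have [k ->] := hE x; rewrite cos2piDint.
  by rewrite (integral_fill_trunc (fun t => cos (2 * pi * h t))) sC mulr0.
transitivity (\int[mu]_x (sin (2 * pi * h (trunc n.+1 x)))%:E)%E.
  by apply: eq_integral => x _; have [k ->] := hE x; rewrite sin2piDint.
by rewrite (integral_fill_trunc (fun t => sin (2 * pi * h t))) sS mulr0.
Qed.

(** Coefficient strings supported on [I], those of the elements of [Lambda] up to level [N]. *)
Let P N (b : {ffun 'I_N -> digit p}) :=
  [forall k : 'I_N, `[< J k >] ==> (b k == ord0)].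

Lemma kernel_sum N (t s : {ffun 'I_N -> digit p}) :
  Omega J phi N (untrunc t) -> Omega J phi N (untrunc s) -> t != s ->
  let h (b : {ffun 'I_N -> digit p}) := pfrac R p (fun k => untrunc b k) N *
    ((zval N (untrunc t))%:R - (zval N (untrunc s))%:R) in
  \sum_(b | P b) cos (2 * pi * h b) = 0 /\
  \sum_(b | P b) sin (2 * pi * h b) = 0.
Proof.
move=> tO sO ts h.
have ex : exists i, (i < N)%N && (untrunc t i != untrunc s i).
  apply: contrapT => /forallNP e; move/eqP: ts; apply.
  apply/ffunP => i; have := e i; rewrite ltn_ord/= !untruncE.
  by move=> /negP/negPn/eqP.
case: (ex_minnP ex) => i /andP[iN tsi] imin.
have tsE : trunc i (untrunc t) = trunc i (untrunc s).
  apply/trunc_eqP => j ji; apply/eqP; apply: contraTT ji => tsj.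
  rewrite -leqNgt; apply: imin; rewrite tsj andbT ltnNge.
  by apply: contra tsj => Nj; rewrite /untrunc !insubN// -leqNgt.
(* At an index of [J], equal preceding digits would force equal digits. *)
have Ji : ~ J i.
  move=> Ji; move/eqP: tsi; apply; move: tO sO; rewrite !OmegaE//= => tO sO.
  by rewrite tO// sO// tsE.
exact: (@dual_orthogonal_sum R p p_gt1 J N _ _ (Ordinal iN)).
Qed.

Lemma Lambda_untrunc N (b : {ffun 'I_N -> digit p}) : P b ->
  Lambda p I (pfrac rat p (fun k => untrunc b k) N).
Proof.
move=> /forallP bP; exists (fun k => untrunc b k), N; split.
  by move=> i; exact: digit_lt.
split=> // i bi; have iN : (i < N)%N.
  by rewrite ltnNge; apply: contra bi => Ni; rewrite /untrunc insubN// -leqNgt.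
split=> //; apply: notJ_I => Ji; have := bP (Ordinal iN); rewrite asboolT//=.
by rewrite -untruncE /= => /eqP e; move: bi; rewrite e.
Qed.

(** Inversion of a finite Fourier transform: the hypotheses say that U + iV has all coefficients 0.
    Multiplying them by exp(2 pi i a(b, s)), summing over [b] and taking real parts isolates
    [U s]. *)
Lemma trigonometric_injective N (U V : {ffun 'I_N -> digit p} -> R) :
  let a (b t : {ffun 'I_N -> digit p}) : R :=
    pfrac R p (fun k => untrunc b k) N * (zval N (untrunc t))%:R in
  (forall t, ~ Omega J phi N (untrunc t) -> U t = 0 /\ V t = 0) ->
  (forall b, P b ->
    \sum_t (U t * cos (2 * pi * a b t) + V t * sin (2 * pi * a b t)) = 0 /\
    \sum_t (V t * cos (2 * pi * a b t) - U t * sin (2 * pi * a b t)) = 0) ->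
  forall s, U s = 0.
Proof.
move=> a null AB s.
have [sO|/null[]//] := pselect (Omega J phi N (untrunc s)).
have : \sum_(b | P b) \sum_t
    (U t * cos (2 * pi * (a b t - a b s)) + V t * sin (2 * pi * (a b t - a b s))) = 0.
  apply: big1 => b /AB[A B].
  transitivity (cos (2 * pi * a b s) *
    (\sum_t (U t * cos (2 * pi * a b t) + V t * sin (2 * pi * a b t))) -
    sin (2 * pi * a b s) *
    (\sum_t (V t * cos (2 * pi * a b t) - U t * sin (2 * pi * a b t)))).
    rewrite !mulr_sumr -sumrB; apply: eq_bigr => t _.
    by rewrite mulrBr cosB sinB; ring.
  by rewrite A B !mulr0 subrr.
(* By [kernel_sum] only the term t = s survives. *)
rewrite exchange_big/= (bigD1 s)//= [X in _ + X]big1 ?addr0; last first.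
  move=> t ts; rewrite big_split/= -!mulr_sumr.
  have [tO|/null[-> ->]] := pselect (Omega J phi N (untrunc t)); last first.
    by rewrite !mul0r addr0.
  have [kC kS] := kernel_sum tO sO ts.
  under eq_bigr do rewrite /a -mulrBr.
  under [X in _ + _ * X]eq_bigr do rewrite /a -mulrBr.
  by rewrite kC kS !mulr0 addr0.
under eq_bigr do rewrite subrr mulr0 cos0 sin0 mulr1 mulr0 addr0.
rewrite -[U s]mulr1 -mulr_sumr => /eqP; rewrite mulf_eq0 => /orP[/eqP->|].
  by rewrite mul0r.
(* The remaining factor counts the strings in [P]; it is positive because the zero string is one of
   them. *)
rewrite gt_eqF// (bigD1 [ffun=> ord0])/=; last first.
  by apply/forallP => k; rewrite ffunE eqxx implybT.
by rewrite ltr_pwDl// sumr_ge0.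
Qed.

(** Characters with coefficients in [P] are functions of the first [N] digits, so the relations
    become linear in the integrals [U], [V] over balls of level [N]. Balls missing [Omega] are
    [mu]-null, and on the others the finite inversion applies. *)
Lemma fill_orthogonal_cylinder (u v : Zpadic p -> R) :
  mu.-integrable setT (EFin \o u) -> mu.-integrable setT (EFin \o v) ->
  (forall l : rat, Lambda p I l ->
     (\int[mu]_x (u x * cos (2 * pi * phase R l x)
                  + v x * sin (2 * pi * phase R l x))%:E = 0)%E /\
     (\int[mu]_x (v x * cos (2 * pi * phase R l x)
                  - u x * sin (2 * pi * phase R l x))%:E = 0)%E) ->
  forall N (s : {ffun 'I_N -> digit p}),
    (\int[mu]_(x in fiber s) (u x)%:E = 0)%E /\
    (\int[mu]_(x in fiber s) (v x)%:E = 0)%E.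
Proof.
move=> iu iv uv0 N s.
have mfib := @measurable_fiber p N.
have null (w : Zpadic p -> R) (t : {ffun 'I_N -> digit p}) :
    mu.-integrable setT (EFin \o w) ->
    ~ Omega J phi N (untrunc t) -> Rintegral mu (fiber t) w = 0.
  move=> iw tO; rewrite /Rintegral null_set_integral//.
    by apply: (measurable_funS measurableT) (measurable_int _ iw).
  by rewrite (fill_fiber p_gt1 m1 mT muE) asboolF.
pose U (t : {ffun 'I_N -> digit p}) := Rintegral mu (fiber t) u.
pose V (t : {ffun 'I_N -> digit p}) := Rintegral mu (fiber t) v.
pose a (b t : {ffun 'I_N -> digit p}) : R :=
  pfrac R p (fun k => untrunc b k) N * (zval N (untrunc t))%:R.
have AB b : P b ->
    \sum_t (U t * cos (2 * pi * a b t) + V t * sin (2 * pi * a b t)) = 0 /\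
    \sum_t (V t * cos (2 * pi * a b t) - U t * sin (2 * pi * a b t)) = 0.
  move=> /Lambda_untrunc/uv0.
  have aE x : exists k : int,
      phase R (pfrac rat p (fun k => untrunc b k) N) x = a b (trunc N x) + k%:~R.
    have [k ->] := phase_pfrac R (fun k => untrunc b k) N x p_prime; exists k.
    by congr (_ * _%:R + _); apply: zval_trunc; rewrite untruncK.
  have mtr (g : _ -> R) := @measurable_fun_trunc p _ _ N g setT.
  move=> [A B]; split; apply: EFin_inj.
    have := @integral_comp_finite_lin _ _ _ _ mu (trunc N : Zpadic p -> _) mfib u v
      _ _ iu iv (mtr (fun t => cos (2 * pi * a b t)))
      (mtr (fun t => sin (2 * pi * a b t))).
    move=> <-; rewrite -[RHS]A; apply: eq_integral => x _; have [k ->] := aE x.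
    by rewrite cos2piDint sin2piDint.
  under eq_bigr do rewrite -mulrN.
  have := @integral_comp_finite_lin _ _ _ _ mu (trunc N : Zpadic p -> _) mfib v u
    _ _ iv iu (mtr (fun t => cos (2 * pi * a b t)))
    (mtr (fun t => - sin (2 * pi * a b t))).
  move=> <-; rewrite -[RHS]B; apply: eq_integral => x _; have [k ->] := aE x.
  by rewrite cos2piDint sin2piDint mulrN.
have fib (w : Zpadic p -> R) : mu.-integrable setT (EFin \o w) ->
    Rintegral mu (fiber s) w = 0 -> (\int[mu]_(x in fiber s) (w x)%:E = 0)%E.
  move=> iw w0; have is' : mu.-integrable (fiber s) (EFin \o w) by exact: integrableS iw.
  by rewrite -(fineK (integrable_fin_num (mfib s) is')); congr EFin.
split; apply: fib => //.
  by apply: (trigonometric_injective (U := U) (V := V)) => // t tO; rewrite /U /V !null.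
(* [v - i u = - i (u + i v)] satisfies the same orthogonality relations. *)
apply: (trigonometric_injective (U := V) (V := fun t => - U t)) => [t tO|b /AB[A B]].
  by rewrite /U /V !null// oppr0.
split; first by rewrite -[RHS]B; apply: eq_bigr => t _; rewrite mulNr.
rewrite -[RHS]oppr0 -[in RHS]A -sumrN; apply: eq_bigr => t _.
by rewrite opprD mulNr.
Qed.

End Spectrum.

Theorem theorem7p1 (R : realType) (p : nat) (hp : prime p) (I J : set nat)
  (hIJ : I `&` J = set0) (hIJU : I `|` J = setT)
  (hI : infinite_set I) (hJ : infinite_set J)
  (phi : forall j : nat, {ffun 'I_j -> digit p} -> digit p)
  (m : {measure set (Zpadic p) -> \bar R})
  (hm1 : m setT = 1%E)
  (hmT : forall (a : Zpadic p) (A : set (Zpadic p)), measurable A ->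
           m (zp_add a @` A) = m A) :
  (forall g : nat, Omega J phi g.+1 `<=` Omega J phi g) /\
  exists mu : probability (Zpadic p) R,
    (forall f : Zpadic p -> R, zp_continuous f ->
       (fun g : nat => fine (\int[m]_(x in Omega J phi g) (f x)%:E)%E
                       / fine (m (Omega J phi g)))
         @ \oo --> fine (\int[mu]_x (f x)%:E)%E) /\
    (exists A : set (Zpadic p), measurable A /\ m A = 0%E /\ mu (~` A) = 0%E) /\
    (forall l l' : rat, Lambda p I l -> Lambda p I l' ->
       (\int[mu]_x (cos (2 * pi * (phase R l x - phase R l' x)))%:E
         = (if l == l' then 1 else 0)%:E)%E /\
       (\int[mu]_x (sin (2 * pi * (phase R l x - phase R l' x)))%:E = 0)%E) /\
    (forall u v : Zpadic p -> R,
       measurable_fun setT u -> measurable_fun setT v ->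
       mu.-integrable setT (fun x => (u x ^+ 2)%:E) ->
       mu.-integrable setT (fun x => (v x ^+ 2)%:E) ->
       (forall l : rat, Lambda p I l ->
          (\int[mu]_x (u x * cos (2 * pi * phase R l x)
                       + v x * sin (2 * pi * phase R l x))%:E = 0)%E /\
          (\int[mu]_x (v x * cos (2 * pi * phase R l x)
                       - u x * sin (2 * pi * phase R l x))%:E = 0)%E) ->
       {ae mu, forall x, u x = 0 /\ v x = 0}).
Proof.
have p1 := prime_gt1 hp; split; first by move=> g; exact: Omega_le.
have [mu muE] := fill_probability J phi p1 hm1.
exists mu; split; first by move=> f; exact: fill_weak_limit.
split; first exact: (fill_singular p1 hm1 hmT muE hJ).
split; first by move=> l l'; exact: (fill_orthonormal hp hIJ hm1 hmT muE).
(* Completeness: u + iv is square integrable and orthogonal to every character, so its integrals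
   over all balls vanish. *)
move=> u v mu_ mv iu2 iv2 uv0.
have mu1 : mu setT = 1%E := mu_setT hm1 muE.
have iu := integrable_sqr_integrable mu1 mu_ iu2.
have iv := integrable_sqr_integrable mu1 mv iv2.
have uv := fill_orthogonal_cylinder hp hIJU hm1 hmT muE iu iv uv0.
have u0 := ae_eq0_cylinder iu (fun n t => (uv n t).1).
have v0 := ae_eq0_cylinder iv (fun n t => (uv n t).2).
by apply: filterS2 u0 v0.
Qed.
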